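(* For the Ising model on the $b$-ary tree, $c_{\mathrm{sob}}(\mu)=c_{\mathrm{gap}}(\mu)\times\Omega(1/\log n)$: for every $b\ge2$, $\beta\ge0$, $h\in\mathbb{R}$ there is a constant $c>0$ depending only on $b,\beta,h$ such that for every boundary condition $\tau$ and every finite complete subtree $T$ with $n\ge2$ vertices, $\mu=\mu_T^\tau$ satisfies $c_{\mathrm{sob}}(\mu)\ge\frac{c}{\log n}\,c_{\mathrm{gap}}(\mu)$. In particular, if $c_{\mathrm{gap}}(\mu)=\Omega(1)$ (i.e. $c_{\mathrm{gap}}(\mu_T^\tau)$ is bounded below by a positive constant uniformly in $T$), then $c_{\mathrm{sob}}(\mu)=\Omega(1/\log n)$.
   Context: Setting. Fix an integer $b\ge2$, $\beta\ge0$ (inverse temperature) and $h\in\mathbb{R}$ (external field). $\mathbb{T}^b$ is the infinite rooted tree in which every vertex has $b$ children. $T$ denotes a finite complete subtree: for some vertex $r$ (the root of $T$) and some $m\ge0$, $T$ consists of $r$ and all its descendants at distance at most $m$ from $r$; $n=|T|=(b^{m+1}-1)/(b-1)$. $\partial T$ is the set of children in $\mathbb{T}^b$ of the leaves of $T$; only edges inside $T\cup\partial T$ are considered. For $A\subseteq T$, $\partial A$ is the set of vertices of $(T\cup\partial T)\setminus A$ adjacent to $A$, and $E(A\cup\partial A)$ is the set of edges with both endpoints in $A\cup\partial A$. A boundary condition is a configuration $\tau\in\{\pm1\}^{\mathbb{T}^b}$; $\Omega=\Omega_T^\tau$ is the set of $\sigma\in\{\pm1\}^{T\cup\partial T}$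 agreeing with $\tau$ on $\partial T$. For $\eta\in\Omega$ and $A\subseteq T$, $\mu_A^\eta$ is the probability measure on $\Omega$ with $\mu_A^\eta(\sigma)\propto\exp[\beta(\sum_{xy\in E(A\cup\partial A)}\sigma_x\sigma_y+h\sum_{x\in A}\sigma_x)]$ if $\sigma$ agrees with $\eta$ outside $A$, and $\mu_A^\eta(\sigma)=0$ otherwise. $\mu=\mu_T^\tau$ is the case $A=T$. $\mathrm{Var}_A(f)$ is the function $\eta\mapsto\mu_A^\eta(f^2)-\mu_A^\eta(f)^2$; $\mathrm{Var}(f)$ and, for $f\ge0$, $\mathrm{Ent}(f)=\mu(f\log f)-\mu(f)\log\mu(f)$ are with respect to $\mu$. Heat-bath Glauber dynamics: $\mathcal{D}(f)=\sum_{x\in T}\mu(\mathrm{Var}_{\{x\}}(f))$, $c_{\mathrm{gap}}(\mu)=\inf_f\mathcal{D}(f)/\mathrm{Var}(f)$ and $c_{\mathrm{sob}}(\mu)=\inf_{f\ge0}\mathcal{D}(\sqrt f)/\mathrm{Ent}(f)$, infima over non-constant functions on $\Omega$. *)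

(* Defs.v *)
From HB Require Import structures.
From mathcomp Require Import all_boot all_order all_algebra.
From mathcomp Require Import all_classical all_reals all_analysis.

Set Implicit Arguments.
Unset Strict Implicit.
Unset Printing Implicit Defensive.

Import Order.TTheory GRing.Theory Num.Theory.
Local Open Scope ring_scope.

(* Vertices of the infinite rooted b-ary tree are finite words over 'I_b; the
   root is [::] and the children of x are the words rcons x i.  Spins are
   booleans, true standing for +1 and false for -1. *)
Definition tree (b : nat) : Type := seq 'I_b.

Definition child (b : nat) (x y : tree b) : bool := [exists i, y == rcons x i].

Definition spin (R : realType) (s : bool) : R := if s then 1 else - 1.

(* T u dT for the complete subtree T with root r and depth m: the word w of
   length at most m+1 stands for the vertex r ++ w.  Since
   child (r ++ x) (r ++ y) = child x y, the edges do not depend on r. *)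
Definition vertex (b m : nat) : finType := {bseq m.+1 of 'I_b}.

Definition subtree (b m : nat) : {set vertex b m} :=
  [set w : vertex b m | (size w <= m)%N]%SET.

(* the children of the leaves of T *)
Definition subtree_bd (b m : nat) : {set vertex b m} :=
  [set w : vertex b m | size w == m.+1]%SET.

Section Sets.
Variables (b m : nat).
Implicit Types (x y : vertex b m) (A : {set vertex b m}).

Definition adj x y : bool := child x y || child y x.

Definition bd A : {set vertex b m} :=
  [set y : vertex b m | (y \notin A) && [exists x in A, adj x y]]%SET.

(* E(A u dA); each edge is listed once, as the pair (parent, child). *)
Definition edges A : {set vertex b m * vertex b m} :=
  [set e : vertex b m * vertex b m |
    [&& e.1 \in A :|: bd A, e.2 \in A :|: bd A & child e.1 e.2]]%SET.

End Sets.

Section Ising.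
Variables (R : realType) (b : nat) (beta h : R).
Variables (tau : tree b -> bool) (r : tree b) (m : nat).

Definition in_Omega (sigma : {ffun vertex b m -> bool}) : bool :=
  [forall w in subtree_bd b m, sigma w == tau (r ++ w)].

Definition Omega : finType := {sigma : {ffun vertex b m -> bool} | in_Omega sigma}.

Definition cfg (sigma : Omega) : {ffun vertex b m -> bool} := val sigma.

Definition tau_cfg : {ffun vertex b m -> bool} :=
  [ffun w : vertex b m => tau (r ++ w)].

Lemma tau_cfg_in_Omega : in_Omega tau_cfg.
Proof. by apply/forall_inP => w _; rewrite ffunE. Qed.

Definition tauT : Omega := exist _ tau_cfg tau_cfg_in_Omega.

Implicit Types (A : {set vertex b m}) (eta sigma : Omega) (f : Omega -> R).

Definition agree_off A eta sigma : bool :=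
  [forall w, (w \notin A) ==> (cfg sigma w == cfg eta w)].

Definition weight A sigma : R :=
  expR (beta * (\sum_(e in edges A) spin R (cfg sigma e.1) * spin R (cfg sigma e.2)
                + h * \sum_(x in A) spin R (cfg sigma x))).

Definition partition_fun A eta : R :=
  \sum_(sigma | agree_off A eta sigma) weight A sigma.

Definition gibbs A eta sigma : R :=
  if agree_off A eta sigma then weight A sigma / partition_fun A eta else 0.

Definition mean A eta f : R := \sum_sigma gibbs A eta sigma * f sigma.

Definition VarA A f eta : R :=
  mean A eta (fun sigma => f sigma ^+ 2) - mean A eta f ^+ 2.

(* mu = mu_T^tau.  Every configuration of Omega agrees with tau outside T, so
   the choice of tauT as the configuration imposed outside T is immaterial. *)
Definition mu f : R := mean (subtree b m) tauT f.

Definition Var f : R := VarA (subtree b m) f tauT.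

(* ln 0 = 0 in the library, so that 0 log 0 = 0. *)
Definition Ent f : R := mu (fun sigma => f sigma * ln (f sigma)) - mu f * ln (mu f).

Definition dirichlet f : R := \sum_(x in subtree b m) mu (VarA [set x]%SET f).

Definition nonconstant f : Prop := exists sigma sigma', f sigma <> f sigma'.

Definition c_gap : R :=
  inf [set q : R | exists f, nonconstant f /\ q = dirichlet f / Var f]%classic.

Definition c_sob : R :=
  inf [set q : R | exists f, [/\ nonconstant f, forall sigma, 0 <= f sigma &
         q = dirichlet (fun sigma => Num.sqrt (f sigma)) / Ent f]]%classic.

End Ising.

(* Main.v *)
Require Import Defs.
From HB Require Import structures.
From mathcomp Require Import all_boot all_order all_algebra.
From mathcomp Require Import all_classical all_reals all_analysis.
From mathcomp Require Import ring lra.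

Set Implicit Arguments.
Unset Strict Implicit.
Unset Printing Implicit Defensive.

Import Order.TTheory GRing.Theory Num.Theory.
Local Open Scope ring_scope.

(* Explore the tree from the root down and apply the chain rule for entropy.
   When the spin at x is revealed, the subtree T_x below x is independent of the
   unexplored rest, so by convexity x contributes at most the entropy, within
   T_x, of a function of the spin at x.  As every spin has conditional
   probability bounded below, this is at most C Var_{T_x}(sqrt f).  The
   conditional law on T_x has bounded density with respect to the marginal of
   mu, so its spectral gap is at least a constant times c_gap(mu), which gives
     Ent(f) <= (C' / c_gap(mu)) sum_x sum_{y in T_x} mu(Var_y(sqrt f)).
   Each y lies in T_x for at most m + 1 = O(log n) vertices x. *)

(** The subtree [T_x] meets the rest of the tree only in the edge above [x], because the spins below
    its leaves are fixed by [tau]. Changing the spins around [T_x] therefore alters a single term of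
    the energy, whatever the size of [T_x]. This makes the density bounds uniform in [tau], [r] and
    [m]. Entropy is traded for variance one spin at a time, since doing it for all of [T_x] at once
    would cost the logarithm of the least probability of a configuration, which grows with [|T_x|].
    For a function of one spin, the ratio to its mean is bounded by a constant. That function is an
    average of [f] over the other spins of [T_x], which is why the variance it leaves is one over
    the whole of [T_x]. The obstacle is that [c_gap] concerns the measure on the full [T] only and
    says nothing directly about the conditional laws on subtrees, hence the comparison of boundary
    conditions. The argument runs for an arbitrary weight with bounded parent-child terms; the Gibbs
    measures are identified with its conditional expectations at the end. *)

(** * Configurations agreeing off a set, and gluing *)

Section Glue.
Variables (b : nat) (tau : tree b -> bool) (r : tree b) (m : nat).
Local Notation Om := (Omega tau r m).
Implicit Types (A B O : {set vertex b m}) (eta xi sigma rho : Om).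

Lemma cfg_inj sigma rho : (forall w, cfg sigma w = cfg rho w) -> sigma = rho.
Proof. by move=> e; apply: val_inj; apply/ffunP. Qed.

Lemma cfg_off_subtree sigma rho w :
  w \notin subtree b m -> cfg sigma w = cfg rho w.
Proof.
rewrite inE -ltnNge => mw.
have wbd : w \in subtree_bd b m by rewrite inE eqn_leq size_bseq.
have E (s : Om) : cfg s w = tau (r ++ w).
  by move/forall_inP: (valP s) => H; apply/eqP/H.
by rewrite !E.
Qed.

Definition glue_cfg A sigma eta : {ffun vertex b m -> bool} :=
  [ffun w => if w \in A then cfg sigma w else cfg eta w].

Lemma glue_in_Omega A sigma eta : in_Omega tau r (glue_cfg A sigma eta).
Proof.
apply/forall_inP => w wbd; rewrite ffunE.
move/forall_inP: (valP sigma) => Hs; move/forall_inP: (valP eta) => He.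
by case: ifP => _; [apply: Hs | apply: He].
Qed.

Definition glue A sigma eta : Om :=
  exist _ (glue_cfg A sigma eta) (glue_in_Omega A sigma eta).

Lemma glueE A sigma eta w :
  cfg (glue A sigma eta) w = if w \in A then cfg sigma w else cfg eta w.
Proof. by rewrite /cfg /= ffunE. Qed.

Lemma agree_offP A eta sigma :
  reflect (forall w, w \notin A -> cfg sigma w = cfg eta w)
          (agree_off A eta sigma).
Proof.
apply: (iffP forallP) => H w; first by move=> wA; apply/eqP/(implyP (H w)).
by apply/implyP => wA; apply/eqP/H.
Qed.

Lemma agree_off_refl A eta : agree_off A eta eta.
Proof. exact/agree_offP. Qed.

Lemma agree_off_sym A eta sigma : agree_off A eta sigma = agree_off A sigma eta.
Proof. by apply/agree_offP/agree_offP => H w wA; rewrite H. Qed.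

Lemma agree_off_trans A xi eta sigma :
  agree_off A eta xi -> agree_off A xi sigma -> agree_off A eta sigma.
Proof.
by move=> /agree_offP H1 /agree_offP H2; apply/agree_offP => w wA; rewrite H2 ?H1.
Qed.

Lemma agree_off_eq A eta xi :
  agree_off A eta xi -> agree_off A eta =1 agree_off A xi.
Proof.
move=> H sigma; apply/idP/idP; last exact: agree_off_trans.
by apply: agree_off_trans; rewrite agree_off_sym.
Qed.

Lemma agree_offW A B eta sigma :
  A \subset B -> agree_off A eta sigma -> agree_off B eta sigma.
Proof.
move=> /fintype.subsetP AB /agree_offP H; apply/agree_offP => w wB; apply: H.
by apply: contra wB; apply: AB.
Qed.

(** Conditioning on the spins off [T] is thus no conditioning: on [T] the conditional quantities
    below are the unconditional ones, whatever configuration is imposed. *)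
Lemma agree_off_subtree eta sigma : agree_off (subtree b m) eta sigma.
Proof. by apply/agree_offP => w; apply: cfg_off_subtree. Qed.

Lemma agree_off_glue A sigma eta : agree_off A eta (glue A sigma eta).
Proof. by apply/agree_offP => w /negPf wA; rewrite glueE wA. Qed.

Lemma glue_agree_off A sigma eta : agree_off A eta sigma -> glue A sigma eta = sigma.
Proof.
move=> /agree_offP H; apply: cfg_inj => w; rewrite glueE.
by case: ifPn => // wA; rewrite H.
Qed.

Lemma glue_glue A sigma eta xi : glue A (glue A sigma eta) xi = glue A sigma xi.
Proof. by apply: cfg_inj => w; rewrite !glueE; case: (w \in A). Qed.

End Glue.

(** * Conditional expectation, variance and entropy for a positive weight *)

Section ConditionalExpectation.
Variables (R : realType) (b : nat) (tau : tree b -> bool) (r : tree b) (m : nat).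
Local Notation Om := (Omega tau r m).
Implicit Types (A B O : {set vertex b m}) (eta xi sigma rho : Om).
Variable W : Om -> R.
Hypothesis W_gt0 : forall sigma, 0 < W sigma.
Implicit Types f g : Om -> R.

Definition Zcond A eta : R := \sum_(sigma | agree_off A eta sigma) W sigma.

(* The expectation of [f] given the spins off [A], for the measure on Omega
   proportional to [W]. *)
Definition cond A f eta : R :=
  (\sum_(sigma | agree_off A eta sigma) W sigma * f sigma) / Zcond A eta.

Definition vcond A f eta : R :=
  cond A (fun sigma => f sigma ^+ 2) eta - cond A f eta ^+ 2.

Definition econd A f eta : R :=
  cond A (fun sigma => f sigma * ln (f sigma)) eta
  - cond A f eta * ln (cond A f eta).

Lemma Zcond_gt0 A eta : 0 < Zcond A eta.
Proof.
rewrite /Zcond (bigD1 eta) ?agree_off_refl //=.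
by rewrite ltr_pwDl // sumr_ge0 // => s _; apply: ltW.
Qed.

Lemma Zcond_agree A eta xi : agree_off A eta xi -> Zcond A xi = Zcond A eta.
Proof. by move=> H; apply: eq_bigl => s; rewrite (agree_off_eq H). Qed.

Lemma cond_agree A f eta xi : agree_off A eta xi -> cond A f xi = cond A f eta.
Proof.
move=> H; rewrite /cond (Zcond_agree H); congr (_ / _).
by apply: eq_bigl => s; rewrite (agree_off_eq H).
Qed.

Lemma eq_cond A f g eta :
  (forall sigma, agree_off A eta sigma -> f sigma = g sigma) ->
  cond A f eta = cond A g eta.
Proof. by move=> H; congr (_ / _); apply: eq_bigr => s /H ->. Qed.

Lemma le_cond A f g eta :
  (forall sigma, agree_off A eta sigma -> f sigma <= g sigma) ->
  cond A f eta <= cond A g eta.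
Proof.
move=> H; rewrite ler_pM2r ?invr_gt0 ?Zcond_gt0 //.
by apply: ler_sum => s /H; rewrite ler_pM2l.
Qed.

Lemma condD A f g eta :
  cond A (fun s => f s + g s) eta = cond A f eta + cond A g eta.
Proof.
rewrite /cond -mulrDl -big_split; congr (_ / _).
by apply: eq_bigr => s _; rewrite mulrDr.
Qed.

Lemma condMr A f g eta : (forall sigma, agree_off A eta sigma -> g sigma = g eta) ->
  cond A (fun s => f s * g s) eta = cond A f eta * g eta.
Proof.
move=> H; rewrite /cond mulrAC [X in _ = X / _]mulr_suml; congr (_ / _).
by apply: eq_bigr => s /H ->; rewrite mulrA.
Qed.

Lemma condZ A c f eta : cond A (fun s => c * f s) eta = c * cond A f eta.
Proof.
rewrite mulrC -(condMr f (g := fun=> c)) //.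
by apply: eq_cond => s _; rewrite mulrC.
Qed.

Lemma condN A f eta : cond A (fun s => - f s) eta = - cond A f eta.
Proof. by rewrite -mulN1r -condZ; apply: eq_cond => s _; rewrite mulN1r. Qed.

Lemma condB A f g eta :
  cond A (fun s => f s - g s) eta = cond A f eta - cond A g eta.
Proof. by rewrite condD condN. Qed.

Lemma cond_cst A c eta : cond A (fun=> c) eta = c.
Proof.
by rewrite /cond -mulr_suml -/(Zcond A eta) mulrAC mulfV ?mul1r // gt_eqF // Zcond_gt0.
Qed.

Lemma cond_inv A f eta : (forall sigma, agree_off A eta sigma -> f sigma = f eta) ->
  cond A f eta = f eta.
Proof. by move=> H; rewrite (eq_cond H) cond_cst. Qed.

Lemma cond_sum (I : finType) (P : pred I) (F : I -> Om -> R) A eta :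
  cond A (fun s => \sum_(i | P i) F i s) eta = \sum_(i | P i) cond A (F i) eta.
Proof.
rewrite /cond -mulr_suml exchange_big /=; congr (_ / _).
by apply: eq_bigr => s _; rewrite mulr_sumr.
Qed.

Lemma cond_ge0 A f eta :
  (forall sigma, agree_off A eta sigma -> 0 <= f sigma) -> 0 <= cond A f eta.
Proof. by move=> H; rewrite -(cond_cst A 0 eta); apply: le_cond. Qed.

Lemma cond_eq0 A f eta : (forall sigma, agree_off A eta sigma -> 0 <= f sigma) ->
  cond A f eta = 0 -> forall sigma, agree_off A eta sigma -> f sigma = 0.
Proof.
move=> H /eqP; rewrite mulf_eq0 invr_eq0 [X in _ || X]gt_eqF ?Zcond_gt0 // orbF.
rewrite psumr_eq0 => [/allP E s sA|s /H]; last by apply: mulr_ge0; apply: ltW.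
have := E s (mem_index_enum _); rewrite sA /= mulf_eq0 gt_eqF //=.
by move/eqP.
Qed.

Lemma cond_tower A B f eta :
  A \subset B -> cond B (cond A f) eta = cond B f eta.
Proof.
move=> AB; congr (_ / _).
under eq_bigr => s _ do rewrite /cond mulrA mulr_sumr mulr_suml.
rewrite (exchange_big_dep (agree_off B eta)) /=; last first.
  by move=> s t Hs Ht; apply: agree_off_trans Hs _; apply: agree_offW Ht.
apply: eq_bigr => t Ht.
rewrite (eq_bigl (agree_off A t)); last first.
  move=> s; rewrite (agree_off_sym A s t) andbC.
  case E: (agree_off A t s) => //=; apply: agree_off_trans Ht _.
  exact: agree_offW E.
rewrite (eq_bigr (fun s => W s * (W t * f t / Zcond A t))); last first.
  by move=> s E; rewrite (Zcond_agree E) !mulrA.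
rewrite -mulr_suml -/(Zcond A t) mulrCA mulfV ?mulr1 //.
by rewrite gt_eqF // Zcond_gt0.
Qed.

(* [W] factorizes over [A] and [O]: given the spins off [A :|: O], those on
   [A] and those on [O] are independent. *)
Lemma cond_comp A O f eta :
  [disjoint A & O]%SET ->
  (forall sigma rho, agree_off A eta sigma -> agree_off O eta rho ->
     W (glue A sigma rho) * W eta = W sigma * W rho) ->
  cond A (cond O f) eta = cond (A :|: O)%SET f eta.
Proof.
move=> dAO ind; rewrite -(cond_tower f eta (finset.subsetUr A O)).
(* Sum the factorization over the spins on [O]; replacing the spins on [A] by those of [s] matches
   the configurations around [eta] with those around [s]. *)
have Zsplit s : agree_off A eta s -> Zcond O s * W eta = W s * Zcond O eta.
  move=> Hs; rewrite mulr_suml mulr_sumr.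
  rewrite (reindex_onto (fun t => glue A s t) (fun t => glue A eta t)) /=; last first.
    move=> t /agree_offP Ht; apply: cfg_inj => w; rewrite !glueE; case: (boolP (w \in A)) => wA //.
    by rewrite Ht // (disjointFr dAO).
  apply: eq_big => [t|t /andP[/agree_offP Ht /eqP E]]; last first.
    apply: ind => //; rewrite -E; apply/agree_offP => w wO; rewrite !glueE.
    case: (boolP (w \in A)) => wA //; have := Ht _ wO.
    by rewrite glueE (negPf wA) => ->; rewrite (agree_offP _ _ _ Hs).
  apply/andP/idP => [[/agree_offP Ht /eqP E]|/agree_offP Ht].
    apply/agree_offP => w wO; rewrite -E !glueE; case: (boolP (w \in A)) => wA //.
    by have := Ht _ wO; rewrite glueE (negPf wA) => ->; rewrite (agree_offP _ _ _ Hs).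
  split.
    apply/agree_offP => w wO; rewrite glueE; case: (boolP (w \in A)) => wA //.
    by rewrite Ht // (agree_offP _ _ _ Hs).
  apply/eqP/cfg_inj => w; rewrite !glueE; case: (boolP (w \in A)) => wA //.
  by rewrite Ht // (disjointFr dAO).
(* For [F] independent of the spins on [O], group the configurations by their spins on [A]: the
   fibre of [s] has mass [Zcond O s], which [Zsplit] makes proportional to [W s]. *)
have key F : (forall s t, agree_off O s t -> F t = F s) ->
    \sum_(s | agree_off (A :|: O)%SET eta s) W s * F s =
    Zcond O eta / W eta * \sum_(s | agree_off A eta s) W s * F s.
  move=> HF; rewrite (partition_big (fun s => glue A s eta) (agree_off A eta)) /=; last first.
    by move=> s _; apply: agree_off_glue.
  rewrite mulr_sumr; apply: eq_bigr => s Hs.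
  have -> : Zcond O eta / W eta * (W s * F s) = Zcond O s * F s.
    have We0 : W eta != 0 by rewrite gt_eqF.
    have -> : Zcond O s = W s * Zcond O eta / W eta by rewrite -Zsplit // mulfK.
    by field.
  rewrite mulr_suml; apply: eq_big => [t|t /andP[/agree_offP Ht /eqP E]].
    apply/andP/idP => [[/agree_offP Ht /eqP <-]|/agree_offP Ht].
      apply/agree_offP => w wO; rewrite glueE; case: (boolP (w \in A)) => wA //.
      by rewrite Ht // inE negb_or wA.
    split.
      apply/agree_offP => w; rewrite inE negb_or => /andP[wA wO].
      by rewrite Ht // (agree_offP _ _ _ Hs).
    apply/eqP/cfg_inj => w; rewrite glueE; case: (boolP (w \in A)) => wA.
      by rewrite Ht // (disjointFr dAO).
    by rewrite (agree_offP _ _ _ Hs).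
  rewrite (HF s t) //; apply/agree_offP => w wO; rewrite -E glueE.
  by case: (boolP (w \in A)) => wA //; rewrite Ht // inE negb_or wA.
have HZ : Zcond (A :|: O)%SET eta = Zcond O eta / W eta * Zcond A eta.
  have Z1 B : Zcond B eta = \sum_(s | agree_off B eta s) W s * 1.
    by apply: eq_bigr => s _; rewrite mulr1.
  by rewrite [LHS]Z1 [Zcond A eta]Z1 (key (fun=> 1)).
rewrite /cond -/(cond O f) key ?HZ; last by move=> s t; apply: cond_agree.
have We0 : W eta != 0 by rewrite gt_eqF.
have Z0 B xi : Zcond B xi != 0 by rewrite gt_eqF // Zcond_gt0.
by field; rewrite We0 !Z0.
Qed.

Lemma cond_sqrB A f c eta : cond A (fun s => (f s - c) ^+ 2) eta =
  cond A (fun s => f s ^+ 2) eta - 2 * c * cond A f eta + c ^+ 2.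
Proof.
rewrite -condZ -condB -[c ^+ 2](cond_cst A (c ^+ 2) eta) -condD.
by apply: eq_cond => s _; ring.
Qed.

Lemma vcond_le A f c eta :
  vcond A f eta <= cond A (fun s => (f s - c) ^+ 2) eta.
Proof.
by rewrite cond_sqrB; have := sqr_ge0 (cond A f eta - c); rewrite /vcond; nra.
Qed.

Lemma vcondE A f eta :
  vcond A f eta = cond A (fun s => (f s - cond A f eta) ^+ 2) eta.
Proof. by rewrite cond_sqrB /vcond; ring. Qed.

Lemma vcond_ge0 A f eta : 0 <= vcond A f eta.
Proof. by rewrite vcondE; apply: cond_ge0 => s _; apply: sqr_ge0. Qed.

Lemma vcond_chain A B f eta : A \subset B ->
  vcond B f eta = cond B (vcond A f) eta + vcond B (cond A f) eta.
Proof. by move=> AB; rewrite /vcond condB !cond_tower //; ring. Qed.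

Lemma econd_chain A B f eta : A \subset B ->
  econd B f eta = cond B (econd A f) eta + econd B (cond A f) eta.
Proof. by move=> AB; rewrite /econd condB !cond_tower //; ring. Qed.

Lemma econd_inv A f eta :
  (forall sigma, agree_off A eta sigma -> f sigma = f eta) -> econd A f eta = 0.
Proof.
move=> H; rewrite /econd (cond_inv H).
rewrite (cond_inv (f := fun s => f s * ln (f s))) ?subrr // => s /H ->//.
Qed.

Lemma vcond_inv A f eta :
  (forall sigma, agree_off A eta sigma -> f sigma = f eta) -> vcond A f eta = 0.
Proof.
move=> H; rewrite /vcond (cond_inv H).
rewrite (cond_inv (f := fun s => f s ^+ 2)) ?subrr // => s /H ->//.
Qed.

End ConditionalExpectation.

(** * Entropy inequalities, and entropy against the variance of the square root *)

Section EntropyBounds.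
Variables (R : realType) (b : nat) (tau : tree b -> bool) (r : tree b) (m : nat).
Local Notation Om := (Omega tau r m).
Implicit Types (A B O : {set vertex b m}) (eta xi sigma rho : Om).
Variable W : Om -> R.
Hypothesis W_gt0 : forall sigma, 0 < W sigma.
Implicit Types f g : Om -> R.

Lemma ln_le_subr1 (x : R) : 0 < x -> ln x <= x - 1.
Proof.
by move=> x0; rewrite -[X in ln X](subrKC 1); apply: le_ln1Dx; lra.
Qed.

(** The left-hand side is the tangent at [u] of the convex function [x ln x]. *)
Lemma xlnx_tangent (x u : R) : 0 <= x -> 0 < u -> x * ln u + x - u <= x * ln x.
Proof.
rewrite le_eqVlt => /predU1P[<- u0|x0 u0]; first by rewrite !mul0r; lra.
have ux : 0 < u / x by rewrite divr_gt0.
have := ln_le_subr1 ux; rewrite ln_div ?posrE // -(ler_pM2l x0) !mulrBr mulr1.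
rewrite mulrCA mulfV ?gt_eqF //.
lra.
Qed.

(* Log-sum inequality; the conventions 0 ln 0 = 0 and ln 0 = 0 make it valid
   also where [f] vanishes. *)
Lemma cond_log_sum A f g eta :
  (forall sigma, 0 <= f sigma) -> (forall sigma, 0 <= g sigma) ->
  (forall sigma, g sigma = 0 -> f sigma = 0) ->
  cond W A f eta * ln (cond W A f eta) - cond W A f eta * ln (cond W A g eta)
  <= cond W A (fun s => f s * ln (f s) - f s * ln (g s)) eta.
Proof.
move=> f0 g0 gf; set p := cond W A f eta; set q := cond W A g eta.
have p0 : 0 <= p by apply: cond_ge0.
have q0 : 0 <= q by apply: cond_ge0.
(* Tangent bound at [t * g sigma]. It is averaged below with [t = p / q], for which the two linear
   terms cancel in the mean. *)
have tangent t sigma : 0 < t ->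
    ln t * f sigma + f sigma - t * g sigma <=
    f sigma * ln (f sigma) - f sigma * ln (g sigma).
  move=> t0; have := g0 sigma; rewrite le_eqVlt => /predU1P[/esym E|g_gt0].
    by rewrite E (gf _ E) !mulr0 !mul0r; lra.
  have := xlnx_tangent (f0 sigma) (mulr_gt0 t0 g_gt0).
  by rewrite lnM ?posrE //; lra.
move: p0; rewrite le_eqVlt => /predU1P[/esym E|p_gt0].
  have fz := cond_eq0 W_gt0 (fun s _ => f0 s) E.
  rewrite E !mul0r subrr cond_ge0 // => s /fz ->; by rewrite !mul0r subrr.
have q_gt0 : 0 < q.
  rewrite lt_neqAle q0 andbT; apply/negP => /eqP/esym E.
  have gz := cond_eq0 W_gt0 (fun s _ => g0 s) E.
  by move: p_gt0; rewrite /p (eq_cond _ (g := fun=> 0)) ?cond_cst ?ltxx // => s /gz/gf.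
have : cond W A (fun s => ln (p / q) * f s + f s - p / q * g s) eta <=
       cond W A (fun s => f s * ln (f s) - f s * ln (g s)) eta.
  by apply: le_cond => // s _; apply: tangent; apply: divr_gt0.
apply: le_trans; rewrite condB condD !condZ -/p -/q ln_div ?posrE //.
by rewrite mulfVK ?gt_eqF //; lra.
Qed.


(** Convexity of entropy. As the two expectations commute, both sides become [cond W A] of
    something: on the right the average over [O] of [f ln f - f ln (cond W A f)], on the left the
    same expression with both arguments averaged first. The log-sum inequality compares them
    pointwise. *)
Lemma econd_cond A O f eta : (forall sigma, 0 <= f sigma) ->
  (forall g xi, cond W A (cond W O g) xi = cond W O (cond W A g) xi) ->
  econd W A (cond W O f) eta <= cond W O (econd W A f) eta.
Proof.
move=> f0 comm; have cA0 s : 0 <= cond W A f s by apply: cond_ge0.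
have -> : econd W A (cond W O f) eta =
    cond W A (fun s => cond W O f s * ln (cond W O f s)
      - cond W O f s * ln (cond W O (cond W A f) s)) eta.
  rewrite /econd condB; congr (_ - _).
  rewrite (condMr _ _ (g := fun s => ln (cond W O (cond W A f) s))) ?comm // => s H.
  by rewrite -!comm (cond_agree _ _ H).
have -> : cond W O (econd W A f) eta =
    cond W A (cond W O (fun s => f s * ln (f s) - f s * ln (cond W A f s))) eta.
  rewrite comm; apply: eq_cond => s _; rewrite /econd condB.
  rewrite (condMr _ _ (g := fun s => ln (cond W A f s))) // => t H.
  by rewrite (cond_agree _ _ H).
apply: le_cond => // s _; apply: cond_log_sum => // t.
by move/(cond_eq0 W_gt0 (fun s _ => f0 s)); apply; apply: agree_off_refl.
Qed.

(* From [ln t <= t - 1], [Ent X] is at most [Var X] over the mean of [X], and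
   [|X - p| <= |sqrt X - sqrt p| (sqrt K + 1) sqrt p] with [p] the mean. *)
Lemma econd_le_vcond_sqrt A f eta K : 0 <= K -> (forall sigma, 0 <= f sigma) ->
  (forall sigma, agree_off A eta sigma -> f sigma <= K * cond W A f eta) ->
  econd W A f eta <= 4 * (K + 1) * vcond W A (fun s => Num.sqrt (f s)) eta.
Proof.
move=> K0 f0; set p := cond W A f eta => fK.
have p0 : 0 <= p by apply: cond_ge0.
set c := cond W A (fun s => Num.sqrt (f s)) eta.
have c0 : 0 <= c by apply: cond_ge0 => // s _; apply: sqrtr_ge0.
have vE : vcond W A (fun s => Num.sqrt (f s)) eta = p - c ^+ 2.
  by congr (_ - _); apply: eq_cond => s _; rewrite sqr_sqrtr.
have v0 : 0 <= p - c ^+ 2 by rewrite -vE vcond_ge0.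
rewrite vE; move: (p0); rewrite le_eqVlt => /predU1P[/esym E|p_gt0].
  have fz := cond_eq0 W_gt0 (fun s _ => f0 s) E.
  apply: (@le_trans _ _ 0); last by rewrite !mulr_ge0 // addr_ge0.
  rewrite /econd -/p E mul0r subr0 (eq_cond _ (g := fun=> 0)) ?cond_cst //.
  by move=> s /fz ->; rewrite mul0r.
set q := Num.sqrt p; have q0 : 0 <= q := sqrtr_ge0 p.
have pE : p = q ^+ 2 by rewrite sqr_sqrtr.
have cq : c <= q by rewrite -(ler_pXn2r (n := 2)) ?nnegrE // -pE -subr_ge0.
have pw s : agree_off A eta s -> f s * ln (f s) - f s * ln p <=
    2 * (K + 1) * (Num.sqrt (f s) - q) ^+ 2 + (f s - p).
  move=> /fK; have := f0 s; rewrite le_eqVlt => /predU1P[<- _|fs_gt0 fs].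
    by rewrite sqrtr0 !mul0r pE; nra.
  have fp : 0 < f s / p by rewrite divr_gt0.
  have H : ln (f s) - ln p <= f s / p - 1.
    by rewrite -ln_div ?posrE //; apply: ln_le_subr1.
  have {}H : f s * ln (f s) - f s * ln p <= (f s - p) ^+ 2 / p + (f s - p).
    have -> : (f s - p) ^+ 2 / p + (f s - p) = f s * (f s / p - 1).
      by field; rewrite gt_eqF.
    by rewrite -mulrBr ler_pM2l.
  apply: le_trans H _; rewrite lerD2r ler_pdivrMr //.
  set u := Num.sqrt (f s); have u0 : 0 <= u := sqrtr_ge0 _.
  have fE : f s = u ^+ 2 by rewrite sqr_sqrtr.
  move: fs; rewrite fE pE => fs.
  have -> : (u ^+ 2 - q ^+ 2) ^+ 2 = (u - q) ^+ 2 * (u + q) ^+ 2 by ring.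
  have -> : 2 * (K + 1) * (u - q) ^+ 2 * q ^+ 2 =
            (u - q) ^+ 2 * (2 * (K + 1) * q ^+ 2) by ring.
  by apply: ler_wpM2l; [exact: sqr_ge0 | have := sqr_ge0 (u - q); lra].
have : econd W A f eta <= 2 * (K + 1) * cond W A (fun s => (Num.sqrt (f s) - q) ^+ 2) eta.
  have -> : econd W A f eta = cond W A (fun s => f s * ln (f s) - f s * ln p) eta.
    by rewrite condB (condMr _ _ (g := fun=> ln p)).
  apply: le_trans (le_cond W_gt0 pw) _.
  by rewrite condD condZ condB cond_cst // subrr addr0.
move/le_trans; apply; rewrite cond_sqrB //.
rewrite (eq_cond _ (g := f)); last by move=> s _; rewrite sqr_sqrtr.
rewrite -/p -/c -/q pE.
(* Moving the centre from [q] to the mean [c] costs the last factor 2: the mean square about [q] is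
   [2 q (q - c)], and [0 <= c <= q]. *)
have -> : 4 * (K + 1) * (q ^+ 2 - c ^+ 2) = 2 * (K + 1) * (2 * (q ^+ 2 - c ^+ 2)) by ring.
by apply: ler_wpM2l; [lra | nra].
Qed.

(** Serves to show that the entropy of a nonconstant function is positive. With [x] and [y] the
    roots of [f] and of its mean, [ln (y / x) <= y / x - 1] bounds [(x - y) ^+ 2] by a function
    whose mean is the entropy. *)
Lemma vcond_sqrt_le_econd A f eta : (forall sigma, 0 <= f sigma) ->
  vcond W A (fun s => Num.sqrt (f s)) eta <= econd W A f eta.
Proof.
move=> f0; set p := cond W A f eta.
have p0 : 0 <= p by apply: cond_ge0.
apply: le_trans (vcond_le W_gt0 _ _ (Num.sqrt p) _) _.
have -> : econd W A f eta = cond W A (fun s => f s * ln (f s) - f s * ln p - f s + p) eta.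
  rewrite condD 2!condB (condMr _ _ (g := fun=> ln p)) // cond_cst //.
  by rewrite subrK.
apply: le_cond => // s sA; have := f0 s; rewrite le_eqVlt => /predU1P[<-|fs0].
  by rewrite sqrtr0 sub0r sqrrN sqr_sqrtr // !mul0r subrr sub0r oppr0 add0r.
have {}p0 : 0 < p.
  rewrite lt_neqAle p0 andbT; apply/negP => /eqP/esym E.
  by have := cond_eq0 W_gt0 (fun s _ => f0 s) E sA => fs; rewrite fs ltxx in fs0.
set x := Num.sqrt (f s); set y := Num.sqrt p.
have x0 : 0 < x by rewrite sqrtr_gt0.
have y0 : 0 < y by rewrite sqrtr_gt0.
have -> : f s = x ^+ 2 by rewrite sqr_sqrtr.
have -> : p = y ^+ 2 by rewrite sqr_sqrtr // ltW.
have := ln_le_subr1 (divr_gt0 y0 x0); rewrite ln_div ?posrE // => H.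
have {}H : x ^+ 2 * (ln y - ln x) <= x * y - x ^+ 2.
  have -> : x * y - x ^+ 2 = x ^+ 2 * (y / x - 1) by field; rewrite gt_eqF.
  by rewrite ler_pM2l // exprn_gt0.
by rewrite !lnXn // !mulr2n; lra.
Qed.

Lemma vcond_neq0 A f eta : vcond W A f eta != 0 <->
  exists2 sigma, agree_off A eta sigma & f sigma <> f eta.
Proof.
split=> [v0|[s sA fs]].
  apply: contrapT => H; case/eqP: v0; apply: vcond_inv => // s sA.
  by apply: contrapT => fs; apply: H; exists s.
apply/eqP; rewrite vcondE // => v0; apply: fs.
have fE t : agree_off A eta t -> f t = cond W A f eta.
  move=> tA; apply/eqP; rewrite -subr_eq0 -sqrf_eq0; apply/eqP.
  by apply: (cond_eq0 W_gt0 _ v0 tA) => u _; apply: sqr_ge0.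
by rewrite !fE // agree_off_refl.
Qed.

End EntropyBounds.

(** * Parents, descendants and counting in the tree *)

Section Geometry.
Variables (b m : nat).
Implicit Types (v w x y : vertex b m) (A : {set vertex b m}).

Lemma parent_proof v : (size (take (size v).-1 v) <= m.+1)%N.
Proof. by rewrite size_take_min (leq_trans (geq_minr _ _)) ?size_bseq. Qed.

(* The root is its own parent. *)
Definition parent v : vertex b m := Bseq (parent_proof v).

Definition descendants x : {set vertex b m} :=
  [set w in subtree b m | prefix x w]%SET.

Lemma size_parent v : size (parent v) = (size v).-1.
Proof. by rewrite /= size_take_min; apply/minn_idPl/leq_pred. Qed.

Lemma prefix_parent v : prefix (parent v) v.
Proof. exact: prefix_take. Qed.

Lemma descendants_sub x : descendants x \subset subtree b m.
Proof. by apply/fintype.subsetP => w; rewrite inE => /andP[]. Qed.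

Lemma descendants_refl x : x \in subtree b m -> x \in descendants x.
Proof. by move=> xT; rewrite inE xT prefix_refl. Qed.

Lemma parent_descendants x v :
  v \in subtree b m -> parent v \in descendants x -> v \in descendants x.
Proof.
move=> vT; rewrite !inE in vT * => /andP[_ H]; rewrite vT /=.
exact: prefix_trans H (prefix_parent v).
Qed.

Lemma descendants_parent x v :
  v \in descendants x -> v != x -> parent v \in descendants x.
Proof.
rewrite !inE => /andP[vT xv] vx.
rewrite size_parent (leq_trans (leq_pred _) vT) /=.
have lt : (size x < size v)%N.
  rewrite ltn_neqAle size_prefix // andbT; apply: contra vx => /eqP E.
  by rewrite -val_eqE /=; move: xv; rewrite prefixE E take_size eq_sym.
move: xv; rewrite !prefixE /= take_takel ?size_take //.
by rewrite -ltnS (ltn_predK lt).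
Qed.

Lemma childE x y : child x y = (0 < size y)%N && (x == parent y).
Proof.
apply/existsP/andP => [[i /eqP E]|[y0 /eqP ->]].
  have sE : size y = (size x).+1 by rewrite E size_rcons.
  by rewrite sE; split => //; rewrite -val_eqE /= sE /= E -cats1 take_size_cat.
have [s [i E]] : exists (s : seq 'I_b) i, y = rcons s i :> seq 'I_b.
  by case/lastP: (y : seq 'I_b) y0 => // s i _; exists s, i.
exists i; rewrite /= E; apply/eqP; congr rcons.
by rewrite size_rcons -cats1 take_size_cat.
Qed.

(** The vertices [v] for which a term depending on the spins at [v] and [parent v] can feel the spin
    at [y]. *)
Definition site_nbhd y : {set vertex b m} :=
  [set v | (v == y) || (parent v == y)]%SET.

Lemma card_site_nbhd y : (#|site_nbhd y| <= b.+1)%N.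
Proof.
pose c (i : 'I_b) : vertex b m := insub_bseq m.+1 (rcons y i).
apply: (@leq_trans #|(y |: (c @: [set: 'I_b]))%SET|).
  apply/subset_leq_card/fintype.subsetP => v; rewrite !inE.
  case: (posnP (size v)) => [/size0nil v0 /orP[->//|/eqP <-]|v0].
    by rewrite -val_eqE /= v0.
  case/orP => [->//|/eqP vy].
  have : child y v by rewrite childE v0 vy eqxx.
  case/existsP => i /eqP E; apply/orP; right; apply/imsetP; exists i => //.
  by apply: val_inj; rewrite /= insubdK -?E // unfold_in size_bseq.
rewrite cardsU1 -addn1 addnC leq_add ?leq_b1 //.
by rewrite (leq_trans (leq_imset_card _ _)) // cardsT card_ord.
Qed.

Lemma sum_descendants (R : realType) (F : vertex b m -> R) :
  (forall y, 0 <= F y) ->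
  \sum_(x in subtree b m) \sum_(y in descendants x) F y <=
  m.+1%:R * \sum_(y in subtree b m) F y.
Proof.
move=> F0; rewrite (exchange_big_dep (mem (subtree b m))) /=; last first.
  by move=> x y _; apply: (fintype.subsetP (descendants_sub x)).
rewrite mulr_sumr; apply: ler_sum => y yT.
rewrite sumr_const -[leLHS]mulr_natl; apply: ler_wpM2r => //; rewrite ler_nat.
pose P := [pred x | (x \in subtree b m) && (y \in descendants x)].
(* Injective on the ancestors of [y], since a prefix of [y] is determined by its length. *)
pose depth (x : vertex b m) : 'I_m.+1 := inord (size x).
suff dI : {in P &, injective depth}.
  by rewrite -(card_in_image dI) -[leqRHS](card_ord m.+1) max_card.
move=> x1 x2; rewrite !inE => /and3P[s1 _ p1] /and3P[s2 _ p2] /(congr1 val).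
rewrite /= !inordK // => E; apply: val_inj => /=.
by move: p1 p2; rewrite !prefixE => /eqP <- /eqP <-; rewrite E.
Qed.

Lemma card_subtree_ge : (b ^ m <= #|subtree b m|)%N.
Proof.
have sz (t : m.-tuple 'I_b) : (size t <= m.+1)%N by rewrite size_tuple.
pose f (t : m.-tuple 'I_b) : vertex b m := Bseq (sz t).
have f_inj : injective f by move=> t u /(congr1 val) /= E; apply: val_inj.
rewrite -[X in (X ^ _)%N]card_ord -card_tuple -cardsT -(card_imset _ f_inj).
apply/subset_leq_card/fintype.subsetP => v /imsetP[t _ ->].
by rewrite inE /= size_tuple.
Qed.

End Geometry.

(** * Comparison of the laws on a set under two boundary conditions *)

Section BoundaryComparison.
Variables (R : realType) (b : nat) (tau : tree b -> bool) (r : tree b) (m : nat).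
Local Notation Om := (Omega tau r m).
Variable W : Om -> R.
Hypothesis W_gt0 : forall sigma, 0 < W sigma.
Variables (K : R) (B : {set vertex b m}) (xi eta : Om).
Hypothesis W_boundary : forall sigma rho,
  agree_off B xi sigma -> agree_off B xi rho ->
  W sigma * W (glue B rho eta) <= K * (W rho * W (glue B sigma eta)).

Lemma cond_boundary (f g : Om -> R) : (forall sigma, 0 <= g sigma) ->
  (forall sigma, agree_off B xi sigma -> f sigma = g (glue B sigma eta)) ->
  cond W B f xi <= K * cond W B g eta.
Proof.
move=> g0 fg.
have reindex_glue (G : Om -> R) : \sum_(s | agree_off B eta s) G s =
    \sum_(s | agree_off B xi s) G (glue B s eta).
  rewrite (reindex_onto (fun s => glue B s eta) (fun s => glue B s xi)); last first.
    by move=> s Hs; rewrite glue_glue glue_agree_off.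
  apply: eq_bigl => s; rewrite agree_off_glue glue_glue /=.
  apply/eqP/idP => [<-|]; [exact: agree_off_glue | exact: glue_agree_off].
rewrite /cond mulrA ler_pdivrMr ?Zcond_gt0 // mulrAC ler_pdivlMr ?Zcond_gt0 //.
rewrite /Zcond !reindex_glue mulr_suml -mulrA mulr_suml mulr_sumr.
apply: ler_sum => s Hs; rewrite mulr_sumr mulr_sumr mulr_sumr.
apply: ler_sum => t Ht; rewrite -fg //.
have f0 : 0 <= f s by rewrite fg.
have := ler_wpM2r f0 (W_boundary Hs Ht).
by rewrite mulrAC [leRHS]mulrC => /le_trans; apply; lra.
Qed.

(** Centring at the mean under [eta] can only increase the mean square under [xi], and leaves a
    nonnegative function to compare. *)
Lemma vcond_boundary (f g : Om -> R) :
  (forall sigma, agree_off B xi sigma -> f sigma = g (glue B sigma eta)) ->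
  vcond W B f xi <= K * vcond W B g eta.
Proof.
move=> fg; apply: le_trans (vcond_le W_gt0 _ _ (cond W B g eta) _) _.
rewrite (vcondE W_gt0 _ g); apply: cond_boundary => [s|s /fg -> //].
exact: sqr_ge0.
Qed.

End BoundaryComparison.

(** * Weights with bounded parent-child interactions: uniform bounds *)

Section TreeField.
Variables (R : realType) (b : nat) (tau : tree b -> bool) (r : tree b) (m : nat).
Local Notation Om := (Omega tau r m).
Local Notation T := (subtree b m).
Implicit Types (A B O : {set vertex b m}) (eta xi sigma rho : Om).
Implicit Types f g : Om -> R.
Variables (phi : vertex b m -> bool -> bool -> R) (M : R).
Hypothesis phiM : forall v s t, `|phi v s t| <= M.

Local Notation loc v s := (phi v (cfg s v) (cfg s (parent v))).

Definition field_weight sigma : R := expR (\sum_v loc v sigma).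
Local Notation W := field_weight.

(** Bounds the ratio of two products of two weights: each of at most [b + 1] vertices contributes
    four local terms of size at most [M]. *)
Definition kappa : R := expR (4 * M * b.+1%:R).

Lemma field_weight_gt0 sigma : 0 < W sigma.
Proof. exact: expR_gt0. Qed.
Local Notation W_gt0 := field_weight_gt0.

Lemma kappa_gt0 : 0 < kappa.
Proof. exact: expR_gt0. Qed.

Lemma field_weight_exchange (S : {set vertex b m}) s1 s2 s3 s4 :
  (#|S| <= b.+1)%N ->
  (forall v, v \notin S -> loc v s1 + loc v s2 = loc v s3 + loc v s4) ->
  W s1 * W s2 <= kappa * (W s3 * W s4).
Proof.
move=> Sb locE; have M0 : 0 <= M.
  by apply: le_trans (phiM (Bseq (leq0n m.+1 : (size [::] <= m.+1)%N)) true true).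
rewrite /W /kappa -!expRD ler_expR -lerBlDr -!big_split -sumrB /=.
rewrite (bigID (mem S)) /= [X in _ + X]big1 ?addr0; last by move=> v /locE ->; rewrite subrr.
apply: (@le_trans _ _ (\sum_(v in S) 4 * M)).
  apply: ler_sum => v _; have H (s : Om) := phiM v (cfg s v) (cfg s (parent v)).
  move: (H s1) (H s2) (H s3) (H s4); rewrite !ler_norml.
  by move=> /andP[? ?] /andP[? ?] /andP[? ?] /andP[? ?]; lra.
rewrite sumr_const -[leLHS]mulr_natr; apply: ler_wpM2l; first lra.
by rewrite ler_nat.
Qed.

(** No local term sees both [A] and [O], so at each vertex the two sides carry the same pair of
    local terms, possibly swapped. *)
Lemma field_weight_indep A O eta : [disjoint A & O]%SET ->
  (forall v, v \in A -> parent v \notin O) ->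
  (forall v, v \in O -> parent v \notin A) ->
  forall sigma rho, agree_off A eta sigma -> agree_off O eta rho ->
  W (glue A sigma rho) * W eta = W sigma * W rho.
Proof.
move=> dAO AO OA s t /agree_offP Hs /agree_offP Ht.
rewrite /W -!expRD -!big_split; congr expR; apply: eq_bigr => v _ /=.
have sA w : w \notin O -> cfg (glue A s t) w = cfg s w /\ cfg t w = cfg eta w.
  move=> wO; rewrite glueE Ht //; case: (boolP (w \in A)) => // wA.
  by rewrite Hs.
have sO w : w \notin A -> cfg (glue A s t) w = cfg t w /\ cfg s w = cfg eta w.
  by move=> wA; rewrite glueE (negPf wA) Hs.
have [vO|vO] := boolP (v \in O).
  have vA : v \notin A by rewrite (disjointFl dAO).
  have [-> ->] := sO _ vA; have [-> ->] := sO _ (OA _ vO).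
  by rewrite addrC.
have [pO|pO] := boolP (parent v \in O).
  have vA : v \notin A by apply: contraL pO; apply: AO.
  have pA : parent v \notin A by rewrite (disjointFl dAO).
  by have [-> ->] := sO _ vA; have [-> ->] := sO _ pA; rewrite addrC.
by have [-> ->] := sA _ vO; have [-> ->] := sA _ pO.
Qed.

Lemma field_weight_site y xi eta sigma rho :
  agree_off [set y]%SET xi sigma -> agree_off [set y]%SET xi rho ->
  W sigma * W (glue [set y]%SET rho eta) <=
  kappa * (W rho * W (glue [set y]%SET sigma eta)).
Proof.
move=> /agree_offP Hs /agree_offP Ht.
apply: (@field_weight_exchange (site_nbhd y)); first exact: card_site_nbhd.
move=> v; rewrite inE negb_or => /andP[vy pvy].
by rewrite !glueE !inE (negPf vy) (negPf pvy) !Hs ?Ht ?inE.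
Qed.

(** Only the local term at [x] links free spins inside the subtree to spins outside it: a vertex
    outside whose parent is inside lies in the boundary of [T], where all configurations agree. *)
Lemma field_weight_descendants x xi eta sigma rho :
  agree_off (descendants x) xi sigma -> agree_off (descendants x) xi rho ->
  W sigma * W (glue (descendants x) rho eta) <=
  kappa * (W rho * W (glue (descendants x) sigma eta)).
Proof.
move=> /agree_offP Hs /agree_offP Ht.
apply: (@field_weight_exchange [set x]%SET); first by rewrite cards1.
move=> v; rewrite inE => vx.
have [vD|vD] := boolP (v \in descendants x).
  by rewrite !glueE vD (descendants_parent vD vx) addrC.
have [pD|pD] := boolP (parent v \in descendants x); last first.
  by rewrite !glueE (negPf vD) (negPf pD) !Hs ?Ht.
have vT : v \notin T by apply: contra vD => vT; apply: parent_descendants pD.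
rewrite !glueE (negPf vD) pD (cfg_off_subtree sigma eta vT).
by rewrite (cfg_off_subtree rho eta vT) addrC.
Qed.

(** * Revealing a single spin *)

Lemma field_weight_flip x sigma rho :
  agree_off [set x]%SET rho sigma -> W sigma <= kappa * W rho.
Proof.
move=> /agree_offP H; rewrite -(ler_pM2r (W_gt0 rho)) -mulrA.
apply: (@field_weight_exchange (site_nbhd x)); first exact: card_site_nbhd.
move=> v; rewrite inE negb_or => /andP[vx pvx].
by rewrite !H ?inE.
Qed.

(** Given the spins off [A], the spin at [x] equals that of [eta] with probability at least
    [1 / (2 * kappa)]: each configuration with this spin stands for at most two, whose weights are
    within a factor [kappa] of its own. *)
Lemma Zcond_setD1 A x eta :
  Zcond W A eta <= 2 * kappa * Zcond W (A :\ x)%SET eta.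
Proof.
rewrite {1}/Zcond (partition_big (fun s => glue (A :\ x)%SET s eta)
  (agree_off (A :\ x)%SET eta)) /=; last by move=> s _; apply: agree_off_glue.
rewrite mulr_sumr; apply: ler_sum => t _.
set P := (X in \sum_(i | X i) _).
have agx s : P s -> agree_off [set x]%SET t s.
  move=> /andP[/agree_offP Hs /eqP <-]; apply/agree_offP => w; rewrite !inE => wx.
  by rewrite glueE !inE wx /=; case: (boolP (w \in A)) => // /Hs.
apply: (@le_trans _ _ (\sum_(s | P s) kappa * W t)).
  by apply: ler_sum => s /agx; apply: field_weight_flip.
rewrite sumr_const -[leLHS]mulr_natl -mulrA; apply: ler_wpM2r.
  by rewrite mulr_ge0 // ltW // ?kappa_gt0 ?W_gt0.
rewrite (ler_nat R _ 2) -card_bool.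
have inj : {in P &, injective (fun s : Om => cfg s x)}.
  move=> s s' /agx/agree_offP Hs /agx/agree_offP Hs' E; apply: cfg_inj => w.
  by have [->//|wx] := eqVneq w x; rewrite Hs ?Hs' ?inE.
by rewrite -(card_in_image inj) max_card.
Qed.

Lemma cond_setD1 A x f eta : (forall sigma, 0 <= f sigma) ->
  cond W (A :\ x)%SET f eta <= 2 * kappa * cond W A f eta.
Proof.
move=> f0; rewrite /cond mulrA ler_pdivrMr ?Zcond_gt0 //; last exact: W_gt0.
rewrite mulrAC ler_pdivlMr ?Zcond_gt0 //; last exact: W_gt0.
have Wf s : 0 <= W s * f s by rewrite mulr_ge0 // ltW // W_gt0.
set N' := \sum_(s | _) _; set N := \sum_(s | _) _.
have NN : N' <= N.
  rewrite /N (bigID (agree_off (A :\ x)%SET eta)) /=.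
  rewrite [X in X + _](eq_bigl (agree_off (A :\ x)%SET eta)); last first.
    move=> s; apply/andP/idP => [[]//|H]; split => //.
    by apply: agree_offW H; apply: subD1set.
  by rewrite -/N' lerDl sumr_ge0.
have Z0 : 0 <= 2 * kappa * Zcond W (A :\ x)%SET eta.
  by rewrite !mulr_ge0 // ltW // ?kappa_gt0 // Zcond_gt0 //; apply: W_gt0.
have N0 : 0 <= N' by apply: sumr_ge0.
apply: le_trans (ler_wpM2l N0 (Zcond_setD1 A x eta)) _.
by apply: le_trans (ler_wpM2r Z0 NN) _; rewrite mulrCA mulrA.
Qed.


(** Averaging over [A] keeps the mean of the square and, the root being concave, can only raise the
    mean of the root. *)
Lemma vcond_sqrt_cond A B f eta : A \subset B -> (forall sigma, 0 <= f sigma) ->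
  vcond W B (fun s => Num.sqrt (cond W A f s)) eta <=
  vcond W B (fun s => Num.sqrt (f s)) eta.
Proof.
move=> AB f0; have cA0 s : 0 <= cond W A f s by apply: (cond_ge0 W_gt0).
rewrite /vcond; apply: lerB.
  rewrite (eq_cond W (g := cond W A f)); last by move=> s _; rewrite sqr_sqrtr.
  rewrite (cond_tower W_gt0) // (eq_cond W (f := fun s => _ ^+ 2) (g := f)) //.
  by move=> s _; rewrite sqr_sqrtr.
have sq0 (h : Om -> R) C xi : 0 <= cond W C (fun s => Num.sqrt (h s)) xi.
  by apply: (cond_ge0 W_gt0) => s _; apply: sqrtr_ge0.
rewrite ler_pXn2r ?nnegrE //.
rewrite -(cond_tower W_gt0 _ _ AB); apply: (le_cond W_gt0) => s _.
rewrite -(ler_pXn2r (n := 2)) ?nnegrE ?sqrtr_ge0 // sqr_sqrtr //.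
have := vcond_ge0 W_gt0 A (fun s => Num.sqrt (f s)) s; rewrite subr_ge0.
by rewrite [X in _ <= X](eq_cond W (g := f)) // => t _; rewrite sqr_sqrtr.
Qed.

Lemma econd_cond_setD1 A x f eta : (forall sigma, 0 <= f sigma) ->
  econd W A (cond W (A :\ x)%SET f) eta <=
  4 * (2 * kappa + 1) * vcond W A (fun s => Num.sqrt (f s)) eta.
Proof.
move=> f0; have sub : (A :\ x)%SET \subset A := subD1set A x.
have k0 := kappa_gt0.
apply: le_trans (econd_le_vcond_sqrt W_gt0 (K := 2 * kappa) _ _ _) _; first lra.
- by move=> s; apply: (cond_ge0 W_gt0).
- move=> s H; rewrite (cond_tower W_gt0) // -(cond_agree W f H).
  exact: cond_setD1.
by apply: ler_wpM2l; [lra | apply: vcond_sqrt_cond].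
Qed.

(** * Exploration from the top down and transfer of the spectral gap *)

Definition descent_closed A : Prop :=
  forall v, v \in T -> parent v \in A -> v \in A.

Lemma descendants_sub_closed A x :
  descent_closed A -> x \in A -> descendants x \subset A.
Proof.
move=> clA xA; apply/fintype.subsetP => v.
have [n] := ubnP (size v); elim: n v => // n IH v vn vD.
have [->//|vx] := eqVneq v x.
apply: clA; first exact: (fintype.subsetP (descendants_sub x)).
have pD := descendants_parent vD vx.
apply: IH pD; rewrite size_parent.
have v0 : (0 < size v)%N.
  rewrite lt0n; apply: contra vx => /eqP v0; move: vD; rewrite inE => /andP[_].
  by rewrite (size0nil v0) prefixs0 -val_eqE /= (size0nil v0) eq_sym.
by move: vn; rewrite -ltnS prednK.
Qed.

(* The chain rule is applied along an exploration of [A] from the top down.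
   Once the spins off [A] are revealed and [x] is a vertex of [A] of least
   depth, the subtree below [x] is independent of the rest [O] of [A]; by
   convexity [cond O] can only decrease the entropy that [x] contributes, so
   that this contribution is controlled by the variance on that subtree alone. *)
Lemma econd_le_sum_vcond A f eta : (forall sigma, 0 <= f sigma) ->
  A \subset T -> descent_closed A ->
  econd W A f eta <= 4 * (2 * kappa + 1) *
    \sum_(x in A) cond W A (vcond W (descendants x) (fun s => Num.sqrt (f s))) eta.
Proof.
move=> f0; have [n] := ubnP #|A|; elim: n A eta => // n IH A eta An AT clA.
have C0 : 0 <= 4 * (2 * kappa + 1) by have := kappa_gt0; lra.
set C := 4 * _ in C0 *.
have [A0|[x0 x0A]] := set_0Vmem A.
  rewrite A0 big_set0 mulr0 (econd_inv W_gt0) // => s /agree_offP H.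
  by congr f; apply: cfg_inj => w; rewrite H // inE.
have [x xA xmin] := @arg_minnP _ x0 (mem A) (fun v : vertex b m => size v) x0A.
have {}xA : x \in A := xA.
have xT : x \in T by apply: (fintype.subsetP AT).
(* Least depth puts the parent of [x] outside [A], except at the root, which is its own parent. *)
have parent_x : parent x \in A -> parent x = x.
  move=> /xmin; rewrite size_parent => sx; apply: val_inj => /=.
  have x0s : size x = 0 by case: (size x) sx => // k; rewrite ltnn.
  by rewrite x0s (size0nil x0s).
set D := descendants x.
have xD : x \in D := descendants_refl xT.
have DA : D \subset A by apply: descendants_sub_closed.
set D' := (D :\ x)%SET; set A' := (A :\ x)%SET; set O := (A :\: D)%SET.
have A'A : A' \subset A := subD1set A x.
have OA : O \subset A by apply: subsetDl.
have D'D : D' \subset D by apply: subD1set.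
have dDO : [disjoint D & O]%SET.
  rewrite finset.disjoints_subset; apply/fintype.subsetP => w wD.
  by rewrite finset.in_setC finset.in_setD wD.
have dD'O : [disjoint D' & O]%SET by apply: disjointWl dDO.
have DOp v : v \in D -> parent v \notin O.
  move=> vD; rewrite inE negb_and negbK.
  have [->|vx] := eqVneq v x; last by rewrite (descendants_parent vD vx).
  by have [/parent_x ->|] := boolP (parent x \in A); rewrite ?xD ?orbT.
have ODp v : v \in O -> parent v \notin D.
  rewrite inE => /andP[vD vA]; apply: contra vD.
  by apply: parent_descendants; apply: (fintype.subsetP AT).
have comm (E : {set vertex b m}) g xi : E \subset D ->
    cond W E (cond W O g) xi = cond W (E :|: O)%SET g xi /\
    cond W O (cond W E g) xi = cond W (E :|: O)%SET g xi.
  move=> /fintype.subsetP ED.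
  have dEO : [disjoint E & O]%SET by apply: disjointWl dDO; apply/fintype.subsetP.
  split; last rewrite finset.setUC; apply: (cond_comp W_gt0) => //.
  - by apply: field_weight_indep => // v; [move/ED/DOp | move/ODp; apply: contra => /ED].
  - by rewrite disjoint_sym.
  - apply: field_weight_indep; rewrite 1?disjoint_sym // => v.
      by move/ODp; apply: contra => /ED.
    by move/ED/DOp.
have DUO : (D :|: O)%SET = A.
  apply/setP => w; rewrite finset.in_setU finset.in_setD.
  by case: (boolP (w \in D)) => //= /(fintype.subsetP DA) ->.
have D'UO : (D' :|: O)%SET = A'.
  apply/setP => w; rewrite finset.in_setU !finset.in_setD1 finset.in_setD.
  case: (eqVneq w x) => [->|_] /=; first by rewrite xD.
  by case: (boolP (w \in D)) => //= /(fintype.subsetP DA) ->.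
have clA' : descent_closed A'.
  move=> v vT; rewrite !inE => /andP[px pA]; rewrite (clA v) // andbT.
  by apply: contra px => /eqP E; rewrite E parent_x // -E.
have A'n : (#|A'| < n)%N by move: An; rewrite (cardsD1 x) xA.
pose G := cond W D' f.
have G0 s : 0 <= G s by apply: (cond_ge0 W_gt0).
have hE : cond W A' f = cond W O G.
  by apply/funext => s; rewrite /G (comm D' f s D'D).2 D'UO.
pose V y := vcond W (descendants y) (fun s => Num.sqrt (f s)).
rewrite (econd_chain W_gt0 f eta A'A) (bigD1 x) //= mulrDr addrC.
apply: lerD.
  (* Averaging [cond W O G] over [D] gives [cond W A G], a constant given the spins off [A]; its
     entropy vanishes and only the entropy within [D] remains. *)
  rewrite hE (econd_chain W_gt0 _ eta DA) [X in _ + X](econd_inv W_gt0) ?addr0; last first.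
    move=> s; rewrite !(comm D G _ (subxx _)).1 DUO => H.
    exact: cond_agree.
  rewrite -condZ -[leRHS](cond_tower W_gt0 _ _ OA).
  rewrite -[leLHS](cond_tower W_gt0 _ _ (subxx A)).
  apply: le_trans (_ : cond W A (cond W O (econd W D G)) eta <= _).
    rewrite (cond_tower W_gt0) //; apply: (le_cond W_gt0) => s _.
    apply: (econd_cond W_gt0) => // g xi.
    by have [-> ->] := comm D g xi (subxx _).
  apply: (le_cond W_gt0) => s _; apply: (le_cond W_gt0) => t _.
  exact: econd_cond_setD1.
have A'T : A' \subset T := fintype.subset_trans A'A AT.
have := le_cond W_gt0 (fun s (_ : agree_off A eta s) => IH A' s A'n A'T clA').
move/le_trans; apply; rewrite -/C condZ cond_sum ler_wpM2l //.
rewrite le_eqVlt; apply/orP; left; apply/eqP; apply: eq_big => [y|y _].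
  by rewrite !inE andbC.
by rewrite (cond_tower W_gt0).
Qed.

(* The conditional law on a subtree given the spins around it differs from the
   marginal of the full measure by a bounded density, so a Poincare inequality
   for the latter, tested on functions of the spins of the subtree, passes to
   the former. *)
Lemma poincare_descendants gap x g eta eta0 : 0 <= gap ->
  (forall f, gap * vcond W T f eta0 <=
     \sum_(y in T) cond W T (vcond W [set y]%SET f) eta0) ->
  gap * vcond W (descendants x) g eta <= kappa ^+ 3 *
    \sum_(y in descendants x) cond W (descendants x) (vcond W [set y]%SET g) eta.
Proof.
move=> gap0 poincare; set D := descendants x.
have k0 := kappa_gt0.
have DT : D \subset T by apply: descendants_sub.
(* Freezing the spins off [D] turns [g] into a test function on all of [T]. The three factors
   [kappa] are spent on replacing [eta] by random surroundings in the variance over [D], on the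
   change of surroundings in the single-site variances, and on returning to the law around [eta]. *)
pose f s := g (glue D s eta).
have vD : vcond W D g eta <= kappa * vcond W T f eta0.
  rewrite -(cond_cst W_gt0 T (vcond W D g eta) eta0).
  apply: (@le_trans _ _ (cond W T (fun s => kappa * vcond W D f s) eta0)).
    apply: (le_cond W_gt0) => xi _; apply: (vcond_boundary W_gt0).
      by move=> s t; apply: field_weight_descendants.
    by move=> s Hs; rewrite /f glue_glue glue_agree_off.
  rewrite condZ ler_pM2l // (vcond_chain W_gt0 f eta0 DT) lerDl.
  exact: (vcond_ge0 W_gt0).
apply: le_trans (ler_wpM2l gap0 vD) _; rewrite mulrCA exprS -mulrA ler_pM2l //.
apply: le_trans (poincare f) _.
rewrite (bigID (mem D)) /= [X in _ + X]big1 ?addr0; last first.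
  move=> y /andP[yT yD]; rewrite (eq_cond W (g := fun=> 0)) ?(cond_cst W_gt0) //.
  move=> s _; apply: (vcond_inv W_gt0) => t /agree_offP Ht; congr g; apply: cfg_inj => w.
  rewrite !glueE; case: (boolP (w \in D)) => // wD; apply: Ht; rewrite inE.
  by apply: contra yD => /eqP <-.
rewrite (eq_bigl (fun y => y \in D)) /=; last first.
  by move=> y; rewrite andbC; case: (boolP (y \in D)) => //= /(fintype.subsetP DT).
rewrite mulr_sumr; apply: ler_sum => y yD.
have site s : vcond W [set y]%SET f s <= kappa * vcond W [set y]%SET g (glue D s eta).
  apply: (vcond_boundary W_gt0).
    by move=> t u; apply: field_weight_site.
  move=> t /agree_offP Ht; congr g; apply: cfg_inj => w; rewrite !glueE finset.in_set1.
  have [->|wy] := eqVneq w y; first by rewrite yD.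
  by case: (boolP (w \in D)) => // wD; rewrite Ht // inE.
apply: le_trans (le_cond W_gt0 (fun s _ => site s)) _.
rewrite condZ expr2 -mulrA ler_pM2l // -(cond_tower W_gt0 _ _ DT).
rewrite -[leRHS](cond_cst W_gt0 T _ eta0); apply: (le_cond W_gt0) => s _.
apply: (cond_boundary W_gt0) => // [t u|t].
  exact: field_weight_descendants.
exact: (vcond_ge0 W_gt0).
Qed.

Lemma log_sobolev_of_poincare gap eta0 f : 0 <= gap ->
  (forall f, gap * vcond W T f eta0 <=
     \sum_(y in T) cond W T (vcond W [set y]%SET f) eta0) ->
  (forall sigma, 0 <= f sigma) ->
  gap * econd W T f eta0 <= 4 * (2 * kappa + 1) * kappa ^+ 3 * m.+1%:R *
    \sum_(y in T) cond W T (vcond W [set y]%SET (fun s => Num.sqrt (f s))) eta0.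
Proof.
move=> gap0 poincare f0; have k0 := kappa_gt0.
have clT : descent_closed T by [].
have := ler_wpM2l gap0 (econd_le_sum_vcond eta0 f0 (subxx T) clT).
set C := 4 * _; have C0 : 0 <= C by rewrite /C; lra.
move: C C0 => C C0; move/le_trans; apply; rewrite mulrCA -2!mulrA ler_wpM2l //.
set g := fun s => Num.sqrt (f s).
rewrite [leLHS]mulr_sumr.
apply: (@le_trans _ _ (\sum_(x in T) \sum_(y in descendants x)
    kappa ^+ 3 * cond W T (vcond W [set y]%SET g) eta0)).
  apply: ler_sum => x xT; rewrite -condZ.
  apply: (le_trans (le_cond W_gt0
    (fun s _ => poincare_descendants x g s gap0 poincare))).
  rewrite condZ cond_sum [leLHS]mulr_sumr; apply: ler_sum => y yD.
  by rewrite (cond_tower W_gt0) // descendants_sub.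
apply: le_trans (sum_descendants _) _.
  move=> y; apply: mulr_ge0; first by rewrite exprn_ge0 // ltW.
  by apply: (cond_ge0 W_gt0) => s _; apply: (vcond_ge0 W_gt0).
by rewrite -mulr_sumr mulrCA.
Qed.

End TreeField.

(** * The Ising measures as such a field, and the constants *)

Section IsingField.
Variables (R : realType) (b : nat) (beta h : R).
Variables (tau : tree b -> bool) (r : tree b) (m : nat).
Hypothesis beta0 : 0 <= beta.
Local Notation Om := (Omega tau r m).
Local Notation T := (subtree b m).
Implicit Types (A : {set vertex b m}) (eta sigma : Om) (f : Om -> R).

(** Each edge is charged to its lower endpoint, so boundary vertices carry an edge term but no field
    term, and the root carries no edge term. *)
Definition ising_local (v : vertex b m) (s t : bool) : R :=
  beta * ((if (0 < size v)%N then spin R s * spin R t else 0) +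
          h * (if v \in T then spin R s else 0)).

Lemma normr_ising_local v s t : `|ising_local v s t| <= beta * (1 + `|h|).
Proof.
have spin1 u : `|spin R u| = 1 by case: u; rewrite /= ?normrN normr1.
rewrite normrM (ger0_norm beta0) ler_wpM2l //.
apply: le_trans (ler_normD _ _) _; apply: lerD.
  by case: ifP => _; rewrite ?normr0 // normrM !spin1 mulr1.
rewrite normrM ler_piMr //.
by case: ifP => _; rewrite ?normr0 // spin1.
Qed.

Local Notation W := (field_weight (tau := tau) (r := r) ising_local).

Lemma edges_subtree e : (e \in edges T) = child e.1 e.2.
Proof.
suff TT w : w \in (T :|: bd T)%SET by rewrite inE !TT.
rewrite finset.in_setU; case: (boolP (w \in T)) => //= wT; rewrite inE wT /=.
move: wT; rewrite inE -ltnNge => mw.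
apply/exists_inP; exists (parent w).
  by rewrite inE size_parent -ltnS (ltn_predK mw) size_bseq.
by rewrite /adj !childE eqxx andbT (leq_ltn_trans _ mw) ?orbT.
Qed.

Lemma weight_subtree sigma : weight beta h T sigma = W sigma.
Proof.
rewrite /weight /field_weight -mulr_sumr big_split /= -mulr_sumr -!big_mkcond.
suff -> : \sum_(e in edges T) spin R (cfg sigma e.1) * spin R (cfg sigma e.2) =
    \sum_(v : vertex b m | (0 < size v)%N)
      spin R (cfg sigma v) * spin R (cfg sigma (parent v)) by [].
rewrite (reindex_onto (fun v : vertex b m => (parent v, v)) snd); last first.
  by move=> [u v]; rewrite edges_subtree childE => /andP[_ /eqP /= ->].
apply: eq_big => [v|v _]; last by rewrite mulrC.
by rewrite edges_subtree childE !eqxx !andbT.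
Qed.

Lemma edges_setW A : A \subset T -> edges A \subset edges T.
Proof.
by move=> AT; apply/fintype.subsetP => e; rewrite edges_subtree inE => /and3P[].
Qed.

(** An edge outside [edges A] has no endpoint in [A], so the weights over [A] and over [T] differ by
    a factor that the spins off [A] determine. *)
Lemma weight_agree_off A eta sigma : A \subset T -> agree_off A eta sigma ->
  weight beta h A sigma * weight beta h T eta =
  weight beta h A eta * weight beta h T sigma.
Proof.
move=> AT /agree_offP H; rewrite /weight -!expRD -!mulrDr; congr (expR (_ * _)).
pose E (B : {set vertex b m * vertex b m}) (s : Om) :=
  \sum_(e in B) spin R (cfg s e.1) * spin R (cfg s e.2) : R.
pose F (B : {set vertex b m}) (s : Om) := \sum_(x in B) spin R (cfg s x) : R.
rewrite -/(E (edges A) sigma) -/(E (edges A) eta) -/(E (edges T) sigma).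
rewrite -/(E (edges T) eta) -/(F A sigma) -/(F A eta) -/(F T sigma) -/(F T eta).
have ET s : E (edges T) s = E (edges A) s + E (edges T :\: edges A)%SET s.
  rewrite /E (big_setID (edges A)) /=; congr (_ + _); apply: eq_bigl => e.
  rewrite finset.in_setI andbC.
  by case: (boolP (e \in edges A)) => //= /(fintype.subsetP (edges_setW AT)) ->.
have FT s : F T s = F A s + F (T :\: A)%SET s.
  rewrite /F (big_setID A) /=; congr (_ + _); apply: eq_bigl => e.
  rewrite finset.in_setI andbC.
  by case: (boolP (e \in A)) => //= /(fintype.subsetP AT) ->.
have EE : E (edges T :\: edges A)%SET eta = E (edges T :\: edges A)%SET sigma.
  apply: eq_bigr => -[u v]; rewrite finset.in_setD edges_subtree /= => /andP[uvA uv].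
  suff [uA vA] : u \notin A /\ v \notin A by rewrite !H.
  split; apply: contra uvA => wA; rewrite inE uv andbT !finset.in_setU wA /=.
    case: (boolP (v \in A)) => //= vA; rewrite inE vA.
    by apply/exists_inP; exists u => //; rewrite /adj uv.
  rewrite andbT; case: (boolP (u \in A)) => //= uA; rewrite inE uA.
  by apply/exists_inP; exists v => //; rewrite /adj uv orbT.
have FF : F (T :\: A)%SET eta = F (T :\: A)%SET sigma.
  by apply: eq_bigr => x; rewrite finset.in_setD => /andP[xA _]; rewrite H.
by rewrite !ET !FT EE FF; ring.
Qed.

(** Consistency of the Gibbs measures (DLR equations): the measure on [A] with boundary [eta] is
    [mu] conditioned on the spins off [A]. *)
Lemma mean_cond A eta f : A \subset T -> mean beta h A eta f = cond W A f eta.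
Proof.
move=> AT; rewrite /mean (bigID (agree_off A eta)) /= [X in _ + X]big1 ?addr0; last first.
  by move=> s /negPf H; rewrite /gibbs H mul0r.
pose c := weight beta h T eta / weight beta h A eta.
have wA0 s B : weight beta h B s != 0 by rewrite gt_eqF // expR_gt0.
have c0 : c != 0 by rewrite mulf_neq0 ?invr_eq0.
have WE s : agree_off A eta s -> W s = c * weight beta h A s.
  move=> H; rewrite -weight_subtree /c mulrAC [_ * weight _ _ A s]mulrC.
  by rewrite weight_agree_off // mulrAC mulfV ?mul1r.
have -> : cond W A f eta = (\sum_(s | agree_off A eta s) weight beta h A s * f s) /
    partition_fun beta h A eta.
  rewrite /cond /Zcond (eq_bigr _ WE) -mulr_sumr.
  rewrite (eq_bigr (fun s => c * (weight beta h A s * f s))); last first.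
    by move=> s /WE ->; rewrite mulrA.
  by rewrite -mulr_sumr -mulf_div mulfV ?mul1r.
rewrite mulr_suml; apply: eq_bigr => s H.
by rewrite /gibbs H mulrAC.
Qed.

Lemma VarA_vcond A eta f : A \subset T -> VarA beta h A f eta = vcond W A f eta.
Proof. by move=> AT; rewrite /VarA !mean_cond. Qed.

Lemma Ent_econd f : Ent beta h f = econd W T f (tauT tau r m).
Proof. by rewrite /Ent /mu !mean_cond. Qed.

Lemma dirichlet_vcond f : dirichlet beta h f =
  \sum_(y in T) cond W T (vcond W [set y]%SET f) (tauT tau r m).
Proof.
apply: eq_bigr => y yT; rewrite /mu mean_cond //.
by apply: eq_cond => s _; rewrite VarA_vcond // finset.sub1set.
Qed.

Lemma dirichlet_ge0 f : 0 <= dirichlet beta h f.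
Proof.
rewrite dirichlet_vcond sumr_ge0 // => y _.
apply: (cond_ge0 (field_weight_gt0 _)) => s _.
exact: (vcond_ge0 (field_weight_gt0 _)).
Qed.

Lemma Var_ge0 f : 0 <= Var beta h f.
Proof. by rewrite /Var VarA_vcond //; apply: (vcond_ge0 (field_weight_gt0 _)). Qed.

Lemma Var_neq0 f : Var beta h f != 0 <-> nonconstant f.
Proof.
rewrite /Var VarA_vcond // (vcond_neq0 (field_weight_gt0 _)); split.
  by case=> s _ fs; exists s, (tauT tau r m).
case=> s [t fst]; have [fs|fs] := eqVneq (f s) (f (tauT tau r m)).
  by exists t; [exact: agree_off_subtree | move=> ft; apply: fst; rewrite fs ft].
by exists s; [exact: agree_off_subtree | apply/eqP].
Qed.

(** Allows the denominator in [c_sob] to be cleared. *)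
Lemma Ent_gt0 f : (forall sigma, 0 <= f sigma) -> nonconstant f ->
  0 < Ent beta h f.
Proof.
move=> f0 ncf; rewrite Ent_econd.
apply: lt_le_trans (vcond_sqrt_le_econd (field_weight_gt0 _) _ _ f0).
rewrite -VarA_vcond // -/(Var beta h _) lt_neqAle Var_ge0 andbT eq_sym.
apply/Var_neq0; case: ncf => s [t fst]; exists s, t => E; apply: fst.
by rewrite -(sqr_sqrtr (f0 s)) E sqr_sqrtr.
Qed.

(** The sets defining [c_gap] and [c_sob] are nonempty, so lower bounds pass to their infima. The
    root lies in [T] for every [m], so its spin is free. *)
Lemma nonconstant_exists : exists2 f : Om -> R,
  nonconstant f & forall sigma, 0 <= f sigma.
Proof.
pose root : vertex b m := [bseq].
pose s : {ffun vertex b m -> bool} :=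
  [ffun w => if w == root then ~~ tau_cfg tau r m root else tau_cfg tau r m w].
have sOm : in_Omega tau r s.
  apply/forall_inP => w; rewrite inE ffunE.
  by have [->//|_ _] := eqVneq w root; rewrite ffunE.
pose sigma : Om := exist _ s sOm.
exists (fun s => (cfg s root)%:R) => [|t]; last exact: ler0n.
exists sigma, (tauT tau r m) => /eqP; rewrite eqr_nat /cfg /= ffunE eqxx.
by case: (tau_cfg _ _ _ _).
Qed.

Lemma c_gap_ge0 : 0 <= c_gap beta h tau r m.
Proof.
apply: lb_le_inf.
  have [f ncf _] := nonconstant_exists.
  by exists (dirichlet beta h f / Var beta h f), f.
by move=> q [f [_ ->]]; rewrite divr_ge0 ?dirichlet_ge0 ?Var_ge0.
Qed.

Lemma c_gap_poincare f : c_gap beta h tau r m * Var beta h f <= dirichlet beta h f.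
Proof.
have [V0|V0] := eqVneq (Var beta h f) 0; first by rewrite V0 mulr0 dirichlet_ge0.
have Vgt0 : 0 < Var beta h f by rewrite lt_neqAle eq_sym V0 Var_ge0.
rewrite -ler_pdivlMr //; apply: ge_inf.
  by exists 0 => q [g [_ ->]]; rewrite divr_ge0 ?dirichlet_ge0 ?Var_ge0.
by exists f; split => //; apply/Var_neq0.
Qed.

Definition sobolev_cst : R :=
  let k := kappa b (beta * (1 + `|h|)) in 4 * (2 * k + 1) * k ^+ 3.

Lemma sobolev_cst_gt0 : 0 < sobolev_cst.
Proof.
have k0 := kappa_gt0 b (beta * (1 + `|h|)).
by rewrite /sobolev_cst mulr_gt0 ?exprn_gt0 //; lra.
Qed.

Lemma c_gap_Ent f : (forall sigma, 0 <= f sigma) ->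
  c_gap beta h tau r m * Ent beta h f <=
  sobolev_cst * m.+1%:R * dirichlet beta h (fun s => Num.sqrt (f s)).
Proof.
move=> f0; rewrite Ent_econd dirichlet_vcond.
apply: (log_sobolev_of_poincare normr_ising_local) => //; first exact: c_gap_ge0.
by move=> g; rewrite -dirichlet_vcond -VarA_vcond //; apply: c_gap_poincare.
Qed.

(** Half the sum of [ln 2 <= ln n] and [m ln 2 <= ln n], with [n] the size of [T]; the second counts
    only the leaves. *)
Lemma depth_le_ln_card : (2 <= b)%N -> (2 <= #|T|)%N ->
  ln 2 / 2 * m.+1%:R <= ln (#|T|%:R) :> R.
Proof.
move=> b2 T2; have ln2 : 0 < ln 2 :> R by rewrite ln_gt0 // ltr1n.
have lnT : ln 2 <= ln #|T|%:R :> R by rewrite ler_ln ?posrE ?ltr0n ?(ltn_trans _ T2) // ler_nat.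
have lnTm : ln 2 * m%:R <= ln #|T|%:R :> R.
  rewrite mulr_natr -lnXn ?ltr0n // ler_ln ?posrE ?exprn_gt0 ?ltr0n ?(ltn_trans _ T2) //.
  rewrite -natrX ler_nat (leq_trans _ (card_subtree_ge b m)) //.
  by case: (m) => // k; rewrite leq_exp2r.
by rewrite -[m.+1%:R]natr1; lra.
Qed.

Lemma c_gap_c_sob : (2 <= b)%N -> (2 <= #|T|)%N ->
  ln 2 / (2 * sobolev_cst) / ln (#|T|%:R) * c_gap beta h tau r m
  <= c_sob beta h tau r m.
Proof.
move=> b2 T2; have lnT := depth_le_ln_card b2 T2.
have ln2 : 0 < ln 2 :> R by rewrite ln_gt0 // ltr1n.
have lnT0 : 0 < ln #|T|%:R :> R by rewrite ln_gt0 // ltr1n.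
apply: lb_le_inf.
  by have [f ncf f0] := nonconstant_exists; eexists; exists f; split.
move=> q [f [ncf f0 ->]]; rewrite ler_pdivlMr ?Ent_gt0 // -[leLHS]mulrA.
have S0 := sobolev_cst_gt0.
have K0 : 0 <= ln 2 / (2 * sobolev_cst) / ln #|T|%:R.
  by apply: ltW; rewrite !divr_gt0 // mulr_gt0.
apply: le_trans (ler_wpM2l K0 (c_gap_Ent f0)) _.
set D := dirichlet beta h _; have D0 : 0 <= D by apply: dirichlet_ge0.
have -> : ln 2 / (2 * sobolev_cst) / ln #|T|%:R * (sobolev_cst * m.+1%:R * D) =
    ln 2 / 2 * m.+1%:R / ln #|T|%:R * D.
  by field; rewrite !gt_eqF.
by rewrite ler_piMl // ler_pdivrMr // mul1r.
Qed.

End IsingField.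

Theorem theorem5p7 (R : realType) (b : nat) (beta h : R)
    (hb : (2 <= b)%N) (hbeta : 0 <= beta) :
  (exists c : R, 0 < c /\
     forall (tau : tree b -> bool) (r : tree b) (m : nat),
       (2 <= #|subtree b m|)%N ->
       c / ln (#|subtree b m|%:R) * c_gap beta h tau r m <= c_sob beta h tau r m)
  /\
  (forall c0 : R, 0 < c0 ->
     exists c1 : R, 0 < c1 /\
       forall tau : tree b -> bool,
         (forall (r : tree b) (m : nat), c0 <= c_gap beta h tau r m) ->
         forall (r : tree b) (m : nat),
           (2 <= #|subtree b m|)%N ->
           c1 / ln (#|subtree b m|%:R) <= c_sob beta h tau r m).
Proof.
have ln2 : 0 < ln 2 :> R by rewrite ln_gt0 // ltr1n.
(* The factor [ln 2 / 2] is the price of replacing [m + 1] by [ln n]; nothing here depends on [tau],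
   [r] or [m]. *)
pose c : R := ln 2 / (2 * sobolev_cst b beta h).
have c0 : 0 < c by rewrite /c divr_gt0 // mulr_gt0 // sobolev_cst_gt0.
split=> [|g g0].
  by exists c; split=> // tau r m T2; apply: c_gap_c_sob.
exists (c * g); split=> [|tau gap r m T2]; first exact: mulr_gt0.
apply: le_trans (c_gap_c_sob h tau r hbeta hb T2); rewrite -/c mulrAC.
apply: ler_wpM2l; last exact: gap.
by apply: divr_ge0; [exact: ltW | rewrite ln_ge0 // ler1n (ltn_trans _ T2)].
Qed.
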